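(* Let $(y_n,\bm{x}_n)_{n=1}^{N}$ be data with $y_n\in\mathbb{R}$ and $\bm{x}_n$ in a factor set $\mathcal{X}$. Let $\mathcal{A}$ be a set of parameters and let $G(p,\bm{x},\bm{a})$ be a real-valued model such that for every $\bm{a}\in\mathcal{A}$ and every $n$ the function $p\mapsto G(p,\bm{x}_n,\bm{a})$ is nondecreasing on $(0,1)$. For $\bm{a}\in\mathcal{A}$ and $p\in(0,1)$ let $L(\bm{a};p)$ be the discrete random variable taking the values $y_n-G(p,\bm{x}_n,\bm{a})$, $n=1,\dots,N$, with equal probabilities. Then, with uniform weight $w(p)\equiv 1$, the calibration problem $$\min_{\bm{a}\in\mathcal{A}}\int_0^1 w(p)\,\bm{\mathcal{E}}_p\big(L(\bm{a};p)\big)\,\mathrm{d}p$$ is equivalent to minimization of the total Continuous Ranked Probability Score over the sample: for every $\bm{a}\in\mathcal{A}$, $$\int_0^1\bm{\mathcal{E}}_p\big(L(\bm{a};p)\big)\,\mathrm{d}p=\frac{1}{2N}\sum_{n=1}^{N}\mathrm{CRPS}\big(G(\cdot,\bm{x}_n,\bm{a}),y_n\big)$$ (both sides in $[0,\infty]$), so the two problems have the same minimizers over $\mathcal{A}$.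
   Context: For $p\in(0,1)$ the pinball loss is $\rho_p(z)=p\,z\,\mathbb{1}_{\{z>0\}}-(1-p)\,z\,\mathbb{1}_{\{z\le 0\}}$, and the (scaled Koenker–Bassett) error of a random variable $Z$ is $\bm{\mathcal{E}}_p(Z)=E[\rho_p(Z)]$. For a quantile function $Q$ on $(0,1)$ and an observation $y\in\mathbb{R}$, the Continuous Ranked Probability Score is $\mathrm{CRPS}(Q,y)=2\int_0^1\rho_p\big(y-Q(p)\big)\,\mathrm{d}p$. *)

(* Defs.v *)
From mathcomp Require Import all_boot all_order all_algebra.
From mathcomp Require Import all_classical all_reals all_analysis.
Set Implicit Arguments.
Unset Strict Implicit.
Unset Printing Implicit Defensive.
Import Order.TTheory GRing.Theory Num.Theory.
Local Open Scope classical_set_scope.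
Local Open Scope ring_scope.

Definition pinball (R : realType) (p z : R) : R :=
  p * z * (0 < z)%R%:R - (1 - p) * z * (z <= 0)%R%:R.

Definition KB_error d (T : measurableType d) (R : realType)
    (P : probability T R) (p : R) (Z : {RV P >-> R}) : \bar R :=
  ('E_P[fun t => pinball p (Z t)])%E.

(* Functions of the confidence level p are total on R; only their values on
   the open interval ]0, 1[ are used. The integrands below are nonnegative
   there, so the integrals live in [0, +oo]. *)
Definition CRPS (R : realType) (Q : R -> R) (y : R) : \bar R :=
  (2%:E * \int[lebesgue_measure]_(p in `]0%R, 1%R[) (pinball p (y - Q p))%:E)%E.

(* Z takes the values v_0, ..., v_(N-1), each index having probability 1/N:
   a value attained by k of the indices has probability k/N. *)
Definition equiprobable d (T : measurableType d) (R : realType)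
    (P : probability T R) (N : nat) (Z : {RV P >-> R}) (v : 'I_N -> R) : Prop :=
  forall z : R, pmf Z z = #|[pred n : 'I_N | (v n == z)%R]|%:R / N%:R.

Definition calibration_objective d (T : measurableType d) (R : realType)
    (P : probability T R) (Theta : Type) (w : R -> R)
    (L : Theta -> R -> {RV P >-> R}) (a : Theta) : \bar R :=
  (\int[lebesgue_measure]_(p in `]0%R, 1%R[) ((w p)%:E * KB_error p (L a p)))%E.

Definition total_CRPS (R : realType) (X Theta : Type) (N : nat)
    (y : 'I_N -> R) (x : 'I_N -> X) (G : R -> X -> Theta -> R) (a : Theta) :
    \bar R :=
  (\sum_(n < N) CRPS (fun p => G p (x n) a) (y n))%E.

Definition minimizers (R : realType) (Theta : Type) (A : set Theta)
    (f : Theta -> \bar R) : set Theta :=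
  [set a | A a /\ forall b, A b -> (f a <= f b)%E].

(* Main.v *)
(** Each side is a finite sum.  For fixed [p] the expectation of [pinball p]
    under [L a p] is the average of the [N] pinball losses, because a value
    attained by [k] indices has probability [k/N] and the attained values carry
    the whole mass.  Monotonicity in [p] is what makes these losses measurable
    in [p], so that the integral of the nonnegative sum is the sum of the
    integrals.  The objectives then agree on [A] up to the factor [1/(2N)]. *)

Require Import Defs.
From mathcomp Require Import all_boot all_order all_algebra.
From mathcomp Require Import all_classical all_reals all_analysis.
From mathcomp Require Import measurable_realfun lra ring.
Set Implicit Arguments.
Unset Strict Implicit.
Unset Printing Implicit Defensive.
Import Order.TTheory GRing.Theory Num.Theory.
Local Open Scope classical_set_scope.
Local Open Scope ring_scope.

(** The two slopes differ by [1], so [p * z] exceeds [(p - 1) * z] by exactly [z] and the sign of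
    [z] selects the branch. In this form measurability needs no case split. *)
Lemma pinball_max (R : realType) (p z : R) :
  pinball p z = Num.max (p * z) ((p - 1) * z).
Proof.
by rewrite /pinball; case: (ltP 0 z) => z0 /=; [rewrite max_l|rewrite max_r];
  nra.
Qed.

Lemma pinball_ge0 (R : realType) (p z : R) : 0 <= p <= 1 -> 0 <= pinball p z.
Proof.
move=> /andP[p0 p1]; rewrite pinball_max le_max.
by case: (leP 0 z) => z0; apply/orP; [left|right]; nra.
Qed.

Lemma measurable_pinball d (T : measurableType d) (R : realType) (D : set T)
    (p z : T -> R) :
  measurable_fun D p -> measurable_fun D z ->
  measurable_fun D (fun t => pinball (p t) (z t)).
Proof.
move=> mp mz.
under eq_fun do rewrite pinball_max.
apply: measurable_maxr; apply: measurable_funM => //.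
exact: measurable_funB.
Qed.

(** The closed rays [[r, +oo[] generate the Borel sets, and the part of [D] where [r <= f] is again
    an interval: a point [u] between two of its points [s <= t] lies in [D] and has
    [r <= f s <= f u]. *)
Lemma nondecreasing_in_measurable (R : realType) (D : set R) (f : R -> R) :
  is_interval D -> (forall s t, D s -> D t -> s <= t -> f s <= f t) ->
  measurable_fun D f.
Proof.
move=> iD f_nd; apply: (measurability (@RGenCInfty.G R)).
  exact: RGenCInfty.measurableE.
move=> /= _ [_] [r] -> <-; apply: is_interval_measurable => s t /=.
rewrite !in_itv/= !andbT => -[Ds fs] [Dt ft] u /andP[su ut].
have Du : D u by apply: (iD s t) => //; rewrite su ut.
by split=> //; rewrite in_itv/= andbT (le_trans fs)// f_nd.
Qed.

Section equiprobable_expectation.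
Local Open Scope ereal_scope.
Context d (T : measurableType d) (R : realType) (P : probability T R).
Variables (N : nat) (Z : {RV P >-> R}) (v : 'I_N -> R).
Hypotheses (N0 : (0 < N)%N) (Zv : equiprobable Z v).

Let mult (n : 'I_N) : nat := #|[pred m : 'I_N | v m == v n]|.

Let mult_gt0 n : (0 < mult n)%N.
Proof. by apply/card_gt0P; exists n; rewrite inE. Qed.

(* [attained_part f] is [f] at the values of [v] and 0 elsewhere: dividing by
   the multiplicities makes the indices sharing a value contribute once. *)
Let attained_part (f : R -> R) (z : R) : R :=
  (\sum_(n < N) f (v n) / (mult n)%:R * \1_[set v n] z)%R.

(** Exactly [mult n] indices share the value [v n]; each contributes [f (v n) / mult n], and the
    indicator kills all other terms. *)
Let attained_partE f n : attained_part f (v n) = f (v n).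
Proof.
rewrite /attained_part (bigID (fun m => v m == v n)) /= [X in (_ + X)%R]big1.
  rewrite addr0 (eq_bigr (fun=> f (v n) / (mult n)%:R)%R) => [|m /eqP vm].
    by rewrite sumr_const -[LHS]mulr_natr divfK// pnatr_eq0 -lt0n mult_gt0.
  by rewrite indicE vm mem_set// mulr1 /mult vm.
move=> m vmn; rewrite indicE memNset ?mulr0// => /= vnm.
by rewrite vnm eqxx in vmn.
Qed.

Let measurable_fiber n : measurable (Z @^-1` [set v n]).
Proof. by rewrite -[X in measurable X]setTI; exact: measurable_funPT. Qed.

(** The indicator of [v n] at [Z] integrates to [pmf Z (v n)], which is [mult n / N]; the
    multiplicity cancels and each index is left with weight [1/N]. *)
Let integral_attained_part (f : R -> R) : (forall z, 0 <= f z)%R ->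
  \int[P]_t (attained_part f (Z t))%:E =
  ((N%:R)^-1 * \sum_(n < N) f (v n))%:E.
Proof.
move=> f0.
under eq_integral do rewrite /attained_part -sumEFin.
have c0 n : (0 <= f (v n) / (mult n)%:R)%R by rewrite divr_ge0.
have mi n : measurable_fun [set: T] (fun t => (\1_[set v n] (Z t))%:E : \bar R).
  apply/measurable_EFinP.
  by apply: measurableT_comp => //; exact: measurable_indic.
rewrite ge0_integral_sum//; last 2 first.
- by move=> n; under eq_fun do rewrite EFinM; exact: measurable_funeM.
- by move=> n t _; rewrite lee_fin mulr_ge0.
rewrite mulr_sumr -sumEFin; apply: eq_bigr => n _.
under eq_integral do rewrite EFinM.
rewrite ge0_integralZl_EFin//.
rewrite (_ : \int[P]_t _ = (pmf Z (v n))%:E).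
  rewrite Zv -EFinM -/(mult n); congr EFin.
  have mn0 : (mult n)%:R != 0%R :> R by rewrite pnatr_eq0 -lt0n mult_gt0.
  by rewrite mulrA divfK// mulrC.
rewrite /pmf fineK ?fin_num_measure//.
by rewrite -(setIT (Z @^-1` _)) -integral_indic.
Qed.

(** [f] and [attained_part f] agree at [Z] on the event [S] that [Z] hits a value of [v]. This event
    has probability one, so the two integrals coincide. *)
Lemma expectation_equiprobable (f : R -> R) :
  (forall z, 0 <= f z)%R -> measurable_fun [set: R] f ->
  'E_P[f \o Z] = ((N%:R)^-1 * \sum_(n < N) f (v n))%:E.
Proof.
move=> f0 mf; rewrite unlock -integral_attained_part//.
pose S := \bigcup_(n in [set: 'I_N]) (Z @^-1` [set v n]).
have mS : measurable S.
  by apply: fin_bigcup_measurable => // n _; exact: measurable_fiber.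
have attainedS g t : S t -> attained_part g (Z t) = g (Z t).
  by move=> [n _ /= ->]; rewrite attained_partE.
have attainedNS g t : ~ S t -> attained_part g (Z t) = 0%R.
  move=> St; rewrite /attained_part big1// => n _.
  by rewrite indicE memNset ?mulr0// => Ztn; apply: St; exists n.
(* The indicator of [S] is [attained_part] of the constant 1 at [Z], so its integral is the average
   of [N] ones. *)
have PS : P S = 1.
  rewrite -(setIT S) -integral_indic//.
  transitivity (\int[P]_t (attained_part (cst 1%R) (Z t))%:E).
    apply: eq_integral => t _; rewrite indicE.
    have [St|St] := pselect (S t); first by rewrite mem_set// attainedS.
    by rewrite memNset// attainedNS.
  rewrite integral_attained_part; last by move=> *; exact: ler01.
  rewrite big_const_ord iter_addr_0 mulVf//.
  by rewrite pnatr_eq0 -lt0n.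
apply: ge0_ae_eq_integral => //.
- by apply/measurable_EFinP; exact: measurableT_comp.
- apply/measurable_EFinP; apply: measurable_sum => n; apply: measurable_funM => //.
  by apply: measurableT_comp => //; exact: measurable_indic.
- by move=> t _; rewrite lee_fin; exact: f0.
- move=> t _; rewrite lee_fin sumr_ge0// => n _.
  by rewrite mulr_ge0// divr_ge0.
exists (~` S); split; first exact: measurableC.
  by apply: etrans (probability_setC P mS) _; rewrite PS subee.
by move=> t /= H St; apply: H => _; rewrite attainedS.
Qed.

End equiprobable_expectation.

(** A positive real factor preserves and reflects the order of extended reals, [+oo] included, and
    minimality compares values on [A] only. *)
Lemma minimizers_scale (R : realType) (Theta : Type) (A : set Theta)
    (f g : Theta -> \bar R) (c : R) : 0 < c ->
  (forall a, A a -> f a = (c%:E * g a)%E) -> minimizers A f = minimizers A g.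
Proof.
move=> c0 fg; apply/seteqP; split=> a [Aa amin]; split=> // b Ab.
  by have := amin b Ab; rewrite !fg// lee_pmul2l.
by rewrite !fg// lee_pmul2l//; exact: amin.
Qed.

Theorem mainTheorem3 (R : realType) (N : nat) (hN : (0 < N)%N)
    (X : Type) (y : 'I_N -> R) (x : 'I_N -> X)
    (Theta : Type) (A : set Theta) (G : R -> X -> Theta -> R)
    (hG : forall a, A a -> forall (n : 'I_N) (p q : R),
       0 < p -> p <= q -> q < 1 -> G p (x n) a <= G q (x n) a)
    (d : measure_display) (T : measurableType d) (P : probability T R)
    (L : Theta -> R -> {RV P >-> R})
    (hL : forall a, A a -> forall p : R, 0 < p -> p < 1 ->
       equiprobable (L a p) (fun n : 'I_N => y n - G p (x n) a)) :
  (forall a, A a ->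
     (0 <= \int[lebesgue_measure]_(p in `]0%R, 1%R[) KB_error p (L a p))%E /\
     (\int[lebesgue_measure]_(p in `]0%R, 1%R[) KB_error p (L a p) =
      ((2 * N%:R)^-1)%:E *
        \sum_(n < N) CRPS (fun p => G p (x n) a) (y n))%E) /\
  minimizers A (calibration_objective (fun=> 1) L) =
  minimizers A (total_CRPS y x G).
Proof.
have N0 : 0 < N%:R :> R by rewrite ltr0n.
have pinball01 (p z : R) : `]0%R, 1%R[%classic p -> (0 <= pinball p z :> R).
  by rewrite /= in_itv/= => /andP[p0 p1]; rewrite pinball_ge0// !ltW.
have KB_errorE a (p : R) : A a -> `]0%R, 1%R[%classic p -> KB_error p (L a p) =
    ((N%:R^-1)%:E * \sum_(n < N) (pinball p (y n - G p (x n) a))%:E)%E.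
  move=> Aa p01; have /andP[p0 p1] : 0 < p < 1 by move: p01; rewrite /= in_itv.
  rewrite /KB_error (expectation_equiprobable hN (hL a Aa p p0 p1)).
  - by rewrite EFinM sumEFin.
  - by move=> z; exact: pinball01.
  - exact: measurable_pinball.
have integralE a : A a ->
    (\int[lebesgue_measure]_(p in `]0%R, 1%R[) KB_error p (L a p) =
      ((2 * N%:R)^-1)%:E * \sum_(n < N) CRPS (fun p => G p (x n) a) (y n))%E.
  move=> Aa.
  have mpin n : measurable_fun (`]0, 1[ : set R)
      (fun p : R => (pinball p (y n - G p (x n) a))%:E).
    apply/measurable_EFinP; apply: measurable_pinball => //.
    apply: measurable_funB => //; apply: nondecreasing_in_measurable.
      exact: interval_is_interval.
    move=> s t /=; rewrite !in_itv/= => /andP[s0 _] /andP[_ t1] st.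
    exact: hG.
  under eq_integral => p /set_mem p01 do rewrite KB_errorE//.
  rewrite ge0_integralZl_EFin//; last 2 first.
  - by move=> p p01; rewrite sume_ge0// => n _; rewrite lee_fin pinball01.
  - exact: emeasurable_sum.
  rewrite ge0_integral_sum//; last by move=> n p p01; rewrite lee_fin pinball01.
  (* Nonnegative integrals let the factor 2 of each CRPS leave the sum even at [+oo]; it turns
     [1/(2N)] into [1/N]. *)
  rewrite /CRPS -ge0_sume_distrr; last first.
    by move=> n _; apply: integral_ge0 => p p01; rewrite lee_fin pinball01.
  by rewrite muleA -EFinM; congr (_%:E * _)%E; field; rewrite gt_eqF.
split=> [a Aa|].
  split; last exact: integralE.
  apply: integral_ge0 => p p01; rewrite KB_errorE// mule_ge0//.
  by rewrite sume_ge0// => n _; rewrite lee_fin pinball01.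
apply: (minimizers_scale (c := (2 * N%:R)^-1)) => [|a Aa].
  by rewrite invr_gt0 mulr_gt0.
rewrite /calibration_objective; under eq_integral do rewrite mul1e.
exact: integralE.
Qed.
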